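(* Let $\mathcal{C}$ be a symmetric monoidal category and let $(X,A,B,\kappa,\alpha,e,\lambda)$ be a split extension of bialgebras in $\mathcal{C}$. Then: (a) $\kappa$ is the kernel of $\alpha$ in the category of bialgebras in $\mathcal{C}$; (b) $\alpha$ is the cokernel of $\kappa$ in the category of bialgebras in $\mathcal{C}$; (c) $e$ is the kernel of $\lambda$ in the category of pointed coalgebras in $\mathcal{C}$. Hence, a split extension of bialgebras is a short exact sequence (i.e. $\kappa$ is the kernel of $\alpha$ and $\alpha$ is the cokernel of $\kappa$).
   Context: $(\mathcal{C},\otimes,I,\sigma)$ is a symmetric monoidal category (associativity and unit isomorphisms are suppressed); $f\cdot g$ denotes composition ($g$ first) and $1_X$ the identity of $X$. An algebra is an object $A$ with morphisms $m\colon A\otimes A\to A$, $u_A\colon I\to A$ with $m\cdot(u_A\otimes 1_A)=1_A=m\cdot(1_A\otimes u_A)$; associativity is NOT required. Algebra morphisms preserve $m$ and $u$. A coalgebra $(C,\Delta,\epsilon_C)$ is coassociative and counital; coalgebra morphisms preserve $\Delta$ and $\epsilon$. A bialgebra (meaning non-associative bialgebra) is $(B,m,u_B,\Delta,\epsilon_B)$, with $(B,m,u_B)$ an algebra, $(B,\Delta,\epsilon_B)$ a coalgebra, and $\Delta\cdot m=(m\otimes m)\cdot(1_B\otimes\sigma_{B,B}\otimes 1_B)\cdot(\Delta\otimes\Delta)$, $\Delta\cdot u_B=u_B\otimes u_B$, $\epsilon_B\cdot m=\epsilon_B\otimes\epsilon_B$, $\epsilon_B\cdot u_B=1_I$. A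 bialgebra morphism is a morphism of algebras and of coalgebras. The unit object $I$ (with its canonical structure) is the zero object of the category of bialgebras, so the zero morphism $X\to Y$ is $u_Y\cdot\epsilon_X$; kernels and cokernels are taken with respect to these. A pointed coalgebra is a coalgebra $C$ with a coalgebra morphism $u_C\colon I\to C$; morphisms are coalgebra morphisms preserving the points; the zero morphism $Y\to C$ is $u_C\cdot\epsilon_Y$. Bialgebras are regarded as pointed coalgebras via their units. Split extension of bialgebras: bialgebras $X,A,B$, bialgebra morphisms $\kappa\colon X\to A$, $\alpha\colon A\to B$, $e\colon B\to A$ and a morphism $\lambda\colon A\to X$ in $\mathcal{C}$ such that (1) $\lambda\cdot\kappa=1_X$, $\alpha\cdot e=1_B$; (2) $\lambda\cdot e=u_X\cdot\epsilon_B$, $\alpha\cdot\kappa=u_B\cdot\epsilon_X$; (3) $m\cdot((\kappa\cdot\lambda)\otimes(e\cdot\alpha))\cdot\Delta=1_A$; (4) $\lambda\cdot m\cdot(\kappa\otimes e)=1_X\otimes\epsilon_B$; (5) $(1_B\otimes\lambda)\cdot(1_B\otimes m)\cdot(1_B\otimes e\otimes\kappa)\cdot(\Delta\otimes 1_X)=(1_B\otimes\lambda)\cdot(1_B\otimes m)\cdot(1_B\otimes e\otimes\kappa)\cdot(\sigma_{B,B}\otimes 1_X)\cdot(\Delta\otimes 1_X)$; (6) $m\cdot(m\otimes 1_A)\cdot(\kappa\otimes e\otimes 1_A)=m\cdot(1_A\otimes m)\cdot(\kappa\otimes e\otimes 1_A)$; (7) $m\cdot(m\otimes 1_A)\cdot(\kappa\otimes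 1_A\otimes e)=m\cdot(1_A\otimes m)\cdot(\kappa\otimes 1_A\otimes e)$; (8) $m\cdot(m\otimes 1_A)\cdot(1_A\otimes\kappa\otimes e)=m\cdot(1_A\otimes m)\cdot(1_A\otimes\kappa\otimes e)$; (9) $\lambda$ is a morphism of coalgebras preserving the unit. *)

(* Defs.v *)
From Stdlib Require Import ssreflect ProofIrrelevance.

Set Implicit Arguments.
Unset Strict Implicit.
Unset Printing Implicit Defensive.

Reserved Notation "f · g" (at level 50, left associativity).
Reserved Notation "a ⊗ b" (at level 40, left associativity).
Reserved Notation "f ⊠ g" (at level 40, left associativity).

(* [f · g] is "g first, then f". *)
Record category := Category {
  obj :> Type;
  hom : obj -> obj -> Type;
  idm : forall a, hom a a;
  comp : forall a b c, hom b c -> hom a b -> hom a c;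
  compA : forall a b c d (h : hom c d) (g : hom b c) (f : hom a b),
    comp h (comp g f) = comp (comp h g) f;
  comp1m : forall a b (f : hom a b), comp (idm b) f = f;
  compm1 : forall a b (f : hom a b), comp f (idm a) = f
}.
Arguments hom {_} _ _.
Arguments idm {_} a.
Arguments comp {_ a b c} _ _.
Notation "f · g" := (comp f g).

Record pointed_category := PointedCategory {
  pcat :> category;
  zob : pcat;
  to_zob : forall a : pcat, hom a zob;
  from_zob : forall a : pcat, hom zob a;
  to_zob_uniq : forall (a : pcat) (f : hom a zob), f = to_zob a;
  from_zob_uniq : forall (a : pcat) (f : hom zob a), f = from_zob a
}.

Definition zero_mor (D : pointed_category) (a b : D) : hom a b :=
  from_zob b · to_zob a.

Definition is_kernel (D : pointed_category) (x a b : D)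
    (k : hom x a) (f : hom a b) : Prop :=
  f · k = zero_mor x b /\
  forall (y : D) (g : hom y a), f · g = zero_mor y b ->
    exists! h : hom y x, k · h = g.

Definition is_cokernel (D : pointed_category) (x a b : D)
    (q : hom a b) (f : hom x a) : Prop :=
  q · f = zero_mor x b /\
  forall (y : D) (g : hom a y), g · f = zero_mor x y ->
    exists! h : hom b y, h · q = g.

Definition is_short_exact (D : pointed_category) (x a b : D)
    (k : hom x a) (q : hom a b) : Prop :=
  is_kernel k q /\ is_cokernel q k.

(* [a ⊗ b] is the tensor product of objects and [f ⊠ g] that of morphisms. *)
Record sym_mon_cat := SymMonCat {
  smcat :> category;
  tens : smcat -> smcat -> smcat;
  tensm : forall a b c d : smcat,
    hom a b -> hom c d -> hom (tens a c) (tens b d);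
  unit_ob : smcat;
  assoc : forall a b c : smcat, hom (tens (tens a b) c) (tens a (tens b c));
  associ : forall a b c : smcat, hom (tens a (tens b c)) (tens (tens a b) c);
  lunit : forall a : smcat, hom (tens unit_ob a) a;
  luniti : forall a : smcat, hom a (tens unit_ob a);
  runit : forall a : smcat, hom (tens a unit_ob) a;
  runiti : forall a : smcat, hom a (tens a unit_ob);
  braid : forall a b : smcat, hom (tens a b) (tens b a);
  tensm1 : forall a b : smcat, tensm (idm a) (idm b) = idm (tens a b);
  tensmM : forall (a b c a' b' c' : smcat) (g : hom b c) (f : hom a b)
      (g' : hom b' c') (f' : hom a' b'),
    tensm (g · f) (g' · f') = tensm g g' · tensm f f';
  assocK : forall a b c, associ a b c · assoc a b c = idm _;
  associK : forall a b c, assoc a b c · associ a b c = idm _;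
  lunitK : forall a, luniti a · lunit a = idm _;
  lunitiK : forall a, lunit a · luniti a = idm _;
  runitK : forall a, runiti a · runit a = idm _;
  runitiK : forall a, runit a · runiti a = idm _;
  braidK : forall a b, braid b a · braid a b = idm _;
  assoc_nat : forall (a b c a' b' c' : smcat)
      (f : hom a a') (g : hom b b') (h : hom c c'),
    assoc a' b' c' · tensm (tensm f g) h
      = tensm f (tensm g h) · assoc a b c;
  lunit_nat : forall (a b : smcat) (f : hom a b),
    lunit b · tensm (idm unit_ob) f = f · lunit a;
  runit_nat : forall (a b : smcat) (f : hom a b),
    runit b · tensm f (idm unit_ob) = f · runit a;
  braid_nat : forall (a b a' b' : smcat) (f : hom a a') (g : hom b b'),
    braid a' b' · tensm f g = tensm g f · braid a b;
  pentagon : forall w x y z,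
    assoc w x (tens y z) · assoc (tens w x) y z
      = tensm (idm w) (assoc x y z) · assoc w (tens x y) z
          · tensm (assoc w x y) (idm z);
  triangle : forall x y,
    tensm (idm x) (lunit y) · assoc x unit_ob y = tensm (runit x) (idm y);
  hexagon : forall x y z,
    assoc y z x · braid x (tens y z) · assoc x y z
      = tensm (idm y) (braid x z) · assoc y x z · tensm (braid x y) (idm z)
}.
Arguments tens {_} _ _.
Arguments tensm {_ a b c d} _ _.
Arguments unit_ob {_}.
Arguments assoc {_} a b c.
Arguments associ {_} a b c.
Arguments lunit {_} a.
Arguments luniti {_} a.
Arguments runit {_} a.
Arguments runiti {_} a.
Arguments braid {_} a b.
Notation "a ⊗ b" := (tens a b).
Notation "f ⊠ g" := (tensm f g).

(* 1_a ⊗ σ_{b,c} ⊗ 1_d with the associativity isomorphisms restored. *)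
Definition mid_swap (C : sym_mon_cat) (a b c d : C) :
    hom ((a ⊗ b) ⊗ (c ⊗ d)) ((a ⊗ c) ⊗ (b ⊗ d)) :=
  associ a c (b ⊗ d)
    · (idm a ⊠ (assoc c b d · (braid b c ⊠ idm d) · associ b c d))
    · assoc a b (c ⊗ d).

(* Algebras are not required to be associative. *)
Record algebra (C : sym_mon_cat) (a : C) := Algebra {
  mul : hom (a ⊗ a) a;
  one : hom unit_ob a;
  mul1m : mul · (one ⊠ idm a) = lunit a;
  mulm1 : mul · (idm a ⊠ one) = runit a
}.

Record coalgebra (C : sym_mon_cat) (c : C) := Coalgebra {
  comul : hom c (c ⊗ c);
  counit : hom c unit_ob;
  comulA : assoc c c c · (comul ⊠ idm c) · comul = (idm c ⊠ comul) · comul;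
  counit1m : lunit c · (counit ⊠ idm c) · comul = idm c;
  counitm1 : runit c · (idm c ⊠ counit) · comul = idm c
}.

Definition is_alg_mor (C : sym_mon_cat) (a b : C)
    (A : algebra a) (B : algebra b) (f : hom a b) : Prop :=
  f · mul A = mul B · (f ⊠ f) /\ f · one A = one B.

Definition is_coalg_mor (C : sym_mon_cat) (a b : C)
    (A : coalgebra a) (B : coalgebra b) (f : hom a b) : Prop :=
  comul B · f = (f ⊠ f) · comul A /\ counit B · f = counit A.

Record bialgebra (C : sym_mon_cat) := Bialgebra {
  bob :> C;
  balg : algebra bob;
  bcoalg : coalgebra bob;
  comul_mul : comul bcoalg · mul balg
    = (mul balg ⊠ mul balg) · mid_swap bob bob bob bob
        · (comul bcoalg ⊠ comul bcoalg);
  comul_one : comul bcoalg · one balg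
    = (one balg ⊠ one balg) · luniti unit_ob;
  counit_mul : counit bcoalg · mul balg
    = lunit unit_ob · (counit bcoalg ⊠ counit bcoalg);
  counit_one : counit bcoalg · one balg = idm unit_ob
}.

Notation bmul B := (mul (balg B)).
Notation bone B := (one (balg B)).
Notation bcomul B := (comul (bcoalg B)).
Notation bcounit B := (counit (bcoalg B)).

Record bialg_mor (C : sym_mon_cat) (X Y : bialgebra C) := BialgMor {
  bmor :> hom (bob X) (bob Y);
  bmor_alg : is_alg_mor (balg X) (balg Y) bmor;
  bmor_coalg : is_coalg_mor (bcoalg X) (bcoalg Y) bmor
}.

Lemma bialg_mor_eq (C : sym_mon_cat) (X Y : bialgebra C)
  (f g : bialg_mor X Y) : bmor f = bmor g -> f = g.
Proof.
case: f g => [f f1 f2] [g g1 g2] /= e.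
by subst g; rewrite (proof_irrelevance _ f1 g1) (proof_irrelevance _ f2 g2).
Qed.

Section Coherence.
Variable C : sym_mon_cat.
Implicit Types a b c x : C.
Local Notation I := (@unit_ob C).

Lemma tensmMl a b c x (g : hom b c) (f : hom a b) :
  (g · f) ⊠ idm x = (g ⊠ idm x) · (f ⊠ idm x).
Proof. by rewrite -tensmM comp1m. Qed.

Lemma tensmMr a b c x (g : hom b c) (f : hom a b) :
  idm x ⊠ (g · f) = (idm x ⊠ g) · (idm x ⊠ f).
Proof. by rewrite -tensmM comp1m. Qed.

Lemma tensm_lr a b c x (f : hom a b) (g : hom c x) :
  f ⊠ g = (f ⊠ idm x) · (idm a ⊠ g).
Proof. by rewrite -tensmM comp1m compm1. Qed.

Lemma tensm_rl a b c x (f : hom a b) (g : hom c x) :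
  f ⊠ g = (idm b ⊠ g) · (f ⊠ idm c).
Proof. by rewrite -tensmM comp1m compm1. Qed.

Lemma cancel_epi a b c (s : hom a b) (r : hom b a) (f g : hom b c) :
  s · r = idm b -> f · s = g · s -> f = g.
Proof.
by move=> sr e; rewrite -(compm1 f) -(compm1 g) -sr !compA e.
Qed.

Lemma cancel_mono a b c (s : hom b c) (r : hom c b) (f g : hom a b) :
  r · s = idm b -> s · f = s · g -> f = g.
Proof.
by move=> rs e; rewrite -(comp1m f) -(comp1m g) -rs -!compA e.
Qed.

Lemma tensm1_inj a b (f g : hom a b) : idm I ⊠ f = idm I ⊠ g -> f = g.
Proof.
by move=> e; apply: (cancel_epi (lunitiK a)); rewrite -!lunit_nat e.
Qed.

Lemma tens1m_inj a b (f g : hom a b) : f ⊠ idm I = g ⊠ idm I -> f = g.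
Proof.
by move=> e; apply: (cancel_epi (runitiK a)); rewrite -!runit_nat e.
Qed.

Lemma lunit_tens a b : lunit (a ⊗ b) · assoc I a b = lunit a ⊠ idm b.
Proof.
apply: tensm1_inj.
apply: (@cancel_epi _ _ _ (assoc I (I ⊗ a) b) (associ _ _ _)); first exact: associK.
apply: (@cancel_epi _ _ _ (assoc I I a ⊠ idm b) (associ _ _ _ ⊠ idm b)).
  by rewrite -tensmMl associK tensm1.
rewrite tensmMr -!compA [(idm I ⊠ assoc _ _ _) · _]compA -pentagon.
rewrite compA triangle -{1}tensm1 -assoc_nat -triangle tensmMl.
by rewrite !compA assoc_nat.
Qed.

Lemma lunit_runit : lunit I = runit I.
Proof.
apply: tens1m_inj; rewrite -lunit_tens -triangle; congr (_ · _).
by apply: (cancel_mono (lunitK I)); rewrite lunit_nat.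
Qed.

Lemma lunit_braid a : lunit a · braid a I = runit a.
Proof.
apply: tens1m_inj; apply: (cancel_mono (braidK a I)).
have h := f_equal (fun f => lunit (I ⊗ a) · f) (hexagon a I I).
rewrite !compA lunit_tens lunit_nat in h.
rewrite -braid_nat -!compA triangle in h.
by rewrite h tensmMl -(lunit_tens a I) !compA.
Qed.

Lemma braid11 : braid I I = idm (I ⊗ I).
Proof.
apply: (cancel_mono (lunitK I)).
by rewrite lunit_braid -lunit_runit compm1.
Qed.

Lemma mid_swap11 : mid_swap I I I I = idm _.
Proof.
rewrite /mid_swap braid11 tensm1 compm1 associK tensm1 compm1.
exact: assocK.
Qed.

End Coherence.

Section Unit.
Variable C : sym_mon_cat.
Local Notation I := (@unit_ob C).

Definition unit_algebra : algebra I.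
Proof.
exists (lunit I) (idm I); rewrite tensm1 compm1 //; exact: lunit_runit.
Defined.

Definition unit_coalgebra : coalgebra I.
Proof.
exists (luniti I) (idm I).
- congr (_ · _); apply: (cancel_epi (s := lunit I ⊠ idm I) (r := luniti I ⊠ idm I)).
    by rewrite -tensmMl lunitiK tensm1.
  rewrite -compA -tensmMl lunitK tensm1 compm1.
  by rewrite lunit_runit -triangle compA -tensmMr lunitK tensm1 comp1m.
- by rewrite tensm1 compm1 lunitiK.
- by rewrite tensm1 compm1 -lunit_runit lunitiK.
Defined.

Definition unit_bialgebra : bialgebra C.
Proof.
exists I unit_algebra unit_coalgebra => /=.
- by rewrite mid_swap11 compm1 -tensmM lunitiK tensm1 lunitK.
- by rewrite tensm1 compm1 comp1m.
- by rewrite tensm1 comp1m compm1.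
- exact: comp1m.
Defined.

End Unit.

Section BialgCat.
Variable C : sym_mon_cat.

Definition bialg_id (X : bialgebra C) : bialg_mor X X.
Proof.
by exists (idm (bob X)); split; rewrite ?tensm1 ?comp1m ?compm1.
Defined.

Definition bialg_comp (X Y Z : bialgebra C)
    (g : bialg_mor Y Z) (f : bialg_mor X Y) : bialg_mor X Z.
Proof.
case: f g => [f [fm fu] [fd fe]] [g [gm gu] [gd ge]]; exists (g · f); split.
- by rewrite -compA fm compA gm -compA -tensmM.
- by rewrite -compA fu.
- by rewrite compA gd -compA fd compA -tensmM.
- by rewrite compA ge.
Defined.

Lemma bialg_compE (X Y Z : bialgebra C)
  (g : bialg_mor Y Z) (f : bialg_mor X Y) :
  bmor (bialg_comp g f) = bmor g · bmor f.
Proof. by case: f g => [f [? ?] [? ?]] [g [? ?] [? ?]]. Qed.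

Definition bialg_cat : category.
Proof.
apply: (@Category (bialgebra C) (@bialg_mor C) bialg_id bialg_comp).
- by move=> *; apply: bialg_mor_eq; rewrite !bialg_compE compA.
- by move=> *; apply: bialg_mor_eq; rewrite bialg_compE comp1m.
- by move=> *; apply: bialg_mor_eq; rewrite bialg_compE compm1.
Defined.

Definition bialg_counit (X : bialgebra C) : bialg_mor X (unit_bialgebra C).
Proof.
exists (bcounit X); split => /=.
- exact: counit_mul.
- exact: counit_one.
- apply: (cancel_mono (lunitK unit_ob)).
  rewrite compA lunitiK comp1m tensm_rl !compA lunit_nat -!compA.
  by rewrite [lunit _ · _]compA counit1m compm1.
- exact: comp1m.
Defined.

Definition bialg_unit (X : bialgebra C) : bialg_mor (unit_bialgebra C) X.
Proof.
exists (bone X); split => /=.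
- by rewrite tensm_lr compA mul1m lunit_nat.
- exact: compm1.
- exact: comul_one.
- exact: counit_one.
Defined.

Definition Bialg : pointed_category.
Proof.
apply: (@PointedCategory bialg_cat (unit_bialgebra C) bialg_counit bialg_unit).
- move=> X f; apply: bialg_mor_eq => /=.
  by have [_ <-] := bmor_coalg f; rewrite /= comp1m.
- move=> X f; apply: bialg_mor_eq => /=.
  by have [_ <-] := bmor_alg f; rewrite /= compm1.
Defined.

Lemma Bialg_zeroE (X Y : Bialg) :
  bmor (zero_mor X Y) = bone Y · bcounit X.
Proof. exact: bialg_compE. Qed.

End BialgCat.

Record pointed_coalgebra (C : sym_mon_cat) := PointedCoalgebra {
  pcob :> C;
  pcoalg : coalgebra pcob;
  point : hom unit_ob pcob;
  point_mor : is_coalg_mor (unit_coalgebra C) pcoalg point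
}.

Definition is_pcoalg_mor (C : sym_mon_cat) (X Y : pointed_coalgebra C)
    (f : hom (pcob X) (pcob Y)) : Prop :=
  is_coalg_mor (pcoalg X) (pcoalg Y) f /\ f · point X = point Y.

Record pcoalg_mor (C : sym_mon_cat) (X Y : pointed_coalgebra C) := PCoalgMor {
  pcmor :> hom (pcob X) (pcob Y);
  pcmorP : is_pcoalg_mor pcmor
}.

Lemma pcoalg_mor_eq (C : sym_mon_cat) (X Y : pointed_coalgebra C)
  (f g : pcoalg_mor X Y) : pcmor f = pcmor g -> f = g.
Proof.
case: f g => [f f1] [g g1] /= e.
by subst g; rewrite (proof_irrelevance _ f1 g1).
Qed.

Section PCoalgCat.
Variable C : sym_mon_cat.

Definition pcoalg_id (X : pointed_coalgebra C) : pcoalg_mor X X.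
Proof.
by exists (idm (pcob X)); split; [split|]; rewrite ?tensm1 ?comp1m ?compm1.
Defined.

Definition pcoalg_comp (X Y Z : pointed_coalgebra C)
    (g : pcoalg_mor Y Z) (f : pcoalg_mor X Y) : pcoalg_mor X Z.
Proof.
case: f g => [f [[fd fe] fu]] [g [[gd ge] gu]]; exists (g · f).
split; first split.
- by rewrite compA gd -compA fd compA -tensmM.
- by rewrite compA ge.
- by rewrite -compA fu.
Defined.

Lemma pcoalg_compE (X Y Z : pointed_coalgebra C)
  (g : pcoalg_mor Y Z) (f : pcoalg_mor X Y) :
  pcmor (pcoalg_comp g f) = pcmor g · pcmor f.
Proof. by case: f g => [f [[? ?] ?]] [g [[? ?] ?]]. Qed.

Definition pcoalg_cat : category.
Proof.
apply: (@Category (pointed_coalgebra C) (@pcoalg_mor C) pcoalg_id pcoalg_comp).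
- by move=> *; apply: pcoalg_mor_eq; rewrite !pcoalg_compE compA.
- by move=> *; apply: pcoalg_mor_eq; rewrite pcoalg_compE comp1m.
- by move=> *; apply: pcoalg_mor_eq; rewrite pcoalg_compE compm1.
Defined.

Definition pcoalg_of_bialg (B : bialgebra C) : pointed_coalgebra C :=
  @PointedCoalgebra C (bob B) (bcoalg B) (bone B)
    (conj (comul_one B) (counit_one B)).

Definition pcoalg_of_bialg_mor (X Y : bialgebra C) (f : bialg_mor X Y) :
    pcoalg_mor (pcoalg_of_bialg X) (pcoalg_of_bialg Y) :=
  @PCoalgMor C (pcoalg_of_bialg X) (pcoalg_of_bialg Y) (bmor f)
    (conj (bmor_coalg f) (proj2 (bmor_alg f))).

Definition unit_pcoalg : pointed_coalgebra C :=
  pcoalg_of_bialg (unit_bialgebra C).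

Definition pcoalg_counit (X : pointed_coalgebra C) : pcoalg_mor X unit_pcoalg.
Proof.
exists (counit (pcoalg X)); split; first split => /=.
- apply: (cancel_mono (lunitK unit_ob)).
  rewrite compA lunitiK comp1m tensm_rl !compA lunit_nat -!compA.
  by rewrite [lunit _ · _]compA counit1m compm1.
- exact: comp1m.
- by case: (point_mor X).
Defined.

Definition pcoalg_point (X : pointed_coalgebra C) : pcoalg_mor unit_pcoalg X.
Proof.
by exists (point X); split; [exact: point_mor | rewrite /= compm1].
Defined.

Definition PCoalg : pointed_category.
Proof.
apply: (@PointedCategory pcoalg_cat unit_pcoalg pcoalg_counit pcoalg_point).
- move=> X f; apply: pcoalg_mor_eq => /=.
  by have [[_ <-] _] := pcmorP f; rewrite /= comp1m.
- move=> X f; apply: pcoalg_mor_eq => /=.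
  by have [_ <-] := pcmorP f; rewrite /= compm1.
Defined.

Lemma PCoalg_zeroE (X Y : PCoalg) :
  pcmor (zero_mor X Y) = point Y · counit (pcoalg X).
Proof. exact: pcoalg_compE. Qed.

End PCoalgCat.

(* The associator is inserted where two bracketings of a triple tensor product
   meet; all other instances are absorbed by the choice of bracketing. *)
Record split_extension (C : sym_mon_cat) := SplitExtension {
  seX : bialgebra C;
  seA : bialgebra C;
  seB : bialgebra C;
  kappa : bialg_mor seX seA;
  alpha : bialg_mor seA seB;
  sect : bialg_mor seB seA;
  lambda : hom (bob seA) (bob seX);
  lambda_kappa : lambda · kappa = idm (bob seX);
  alpha_sect : alpha · sect = idm (bob seB);
  lambda_sect : lambda · sect = bone seX · bcounit seB;
  alpha_kappa : alpha · kappa = bone seB · bcounit seX;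
  split_decomp :
    bmul seA · ((kappa · lambda) ⊠ (sect · alpha)) · bcomul seA
      = idm (bob seA);
  lambda_mul :
    lambda · bmul seA · (kappa ⊠ sect)
      = runit (bob seX) · (idm (bob seX) ⊠ bcounit seB);
  lambda_comm :
    (idm (bob seB) ⊠ lambda) · (idm (bob seB) ⊠ bmul seA)
        · (idm (bob seB) ⊠ (sect ⊠ kappa))
        · assoc (bob seB) (bob seB) (bob seX)
        · (bcomul seB ⊠ idm (bob seX))
      = (idm (bob seB) ⊠ lambda) · (idm (bob seB) ⊠ bmul seA)
        · (idm (bob seB) ⊠ (sect ⊠ kappa))
        · assoc (bob seB) (bob seB) (bob seX)
        · (braid (bob seB) (bob seB) ⊠ idm (bob seX))
        · (bcomul seB ⊠ idm (bob seX));
  mulA_ke1 :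
    bmul seA · (bmul seA ⊠ idm (bob seA)) · ((kappa ⊠ sect) ⊠ idm (bob seA))
      = bmul seA · (idm (bob seA) ⊠ bmul seA)
        · assoc (bob seA) (bob seA) (bob seA)
        · ((kappa ⊠ sect) ⊠ idm (bob seA));
  mulA_k1e :
    bmul seA · (bmul seA ⊠ idm (bob seA)) · ((kappa ⊠ idm (bob seA)) ⊠ sect)
      = bmul seA · (idm (bob seA) ⊠ bmul seA)
        · assoc (bob seA) (bob seA) (bob seA)
        · ((kappa ⊠ idm (bob seA)) ⊠ sect);
  mulA_1ke :
    bmul seA · (bmul seA ⊠ idm (bob seA)) · ((idm (bob seA) ⊠ kappa) ⊠ sect)
      = bmul seA · (idm (bob seA) ⊠ bmul seA)
        · assoc (bob seA) (bob seA) (bob seA)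
        · ((idm (bob seA) ⊠ kappa) ⊠ sect);
  lambda_pcoalg :
    @is_pcoalg_mor C (pcoalg_of_bialg seA) (pcoalg_of_bialg seX) lambda
}.

Definition lambda_mor (C : sym_mon_cat) (E : split_extension C) :
    pcoalg_mor (pcoalg_of_bialg (seA E)) (pcoalg_of_bialg (seX E)) :=
  PCoalgMor (lambda_pcoalg E).

(* Main.v *)
(* Condition (3) writes the identity of A as the convolution product
   (kappa lambda) * (sect alpha).  If g : Y -> A satisfies alpha g = 0, then
   precomposing with g makes the second factor the convolution unit, so
   g = kappa (lambda g); symmetrically lambda g = 0 gives g = sect (alpha g).
   If g : A -> Y satisfies g kappa = 0, postcomposing makes the first factor the
   convolution unit, so g = (g sect) alpha. *)
From Stdlib Require Import ssreflect.
Require Import Defs.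

Section Convolution.
Variables (C : sym_mon_cat) (c a : C) (D : coalgebra c) (M : algebra a).

(** The unit law of [M] turns the multiplication into [runit a], naturality carries the unitor past
    [f], and the counit law of [D] cancels what remains. *)
Lemma convolutionm1 (f : hom c a) :
  mul M · (f ⊠ (one M · counit D)) · comul D = f.
Proof.
rewrite tensm_rl tensmMr compA compA mulm1 -(compA (runit a)) -tensm_rl tensm_lr.
by rewrite compA runit_nat -2!compA (compA (runit c)) counitm1 compm1.
Qed.

Lemma convolution1m (f : hom c a) :
  mul M · ((one M · counit D) ⊠ f) · comul D = f.
Proof.
rewrite tensm_lr tensmMl compA compA mul1m -(compA (lunit a)) -tensm_lr tensm_rl.
by rewrite compA lunit_nat -2!compA (compA (lunit c)) counit1m compm1.
Qed.

End Convolution.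

Section SplitExtension.
Context {C : sym_mon_cat} (E : split_extension C).
Local Notation X := (seX E).
Local Notation A := (seA E).
Local Notation B := (seB E).
Local Notation κ := (bmor (kappa E)).
Local Notation α := (bmor (alpha E)).
Local Notation e := (bmor (sect E)).
Local Notation λ := (lambda E).

(** Precomposition with a comultiplicative [g] distributes over convolution, so condition (3) passes
    from [idm] to [g]. *)
Lemma split_decomp_coalg_mor {y : C} {Y : coalgebra y} {g : hom y (bob A)} :
  is_coalg_mor Y (bcoalg A) g ->
  bmul A · ((κ · (λ · g)) ⊠ (e · (α · g))) · comul Y = g.
Proof.
move=> [gd _]; rewrite !compA tensmM compA -(compA _ (g ⊠ g)) -gd compA.
by rewrite split_decomp comp1m.
Qed.

(** Since [e] preserves the unit, [e · (α · g)] is the convolution unit. *)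
Lemma kappa_lambda_factor {y : C} {Y : coalgebra y} {g : hom y (bob A)} :
  is_coalg_mor Y (bcoalg A) g -> α · g = bone B · counit Y ->
  κ · (λ · g) = g.
Proof.
move=> gD ag; rewrite -{2}(split_decomp_coalg_mor gD) ag (compA e).
by rewrite (proj2 (bmor_alg (sect E))) convolutionm1.
Qed.

Lemma sect_alpha_factor {y : C} {Y : coalgebra y} {g : hom y (bob A)} :
  is_coalg_mor Y (bcoalg A) g -> λ · g = bone X · counit Y ->
  e · (α · g) = g.
Proof.
move=> gD lg; rewrite -{2}(split_decomp_coalg_mor gD) lg (compA κ).
by rewrite (proj2 (bmor_alg (kappa E))) convolution1m.
Qed.

Lemma alpha_cofactor {y : C} {Y : algebra y} {g : hom (bob A) y} :
  is_alg_mor (balg A) Y g -> g · κ = one Y · bcounit X ->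
  g · e · α = g.
Proof.
move=> [gm _] gk; have [[_ le] _] := lambda_pcoalg E; rewrite /= in le.
rewrite -{2}(compm1 g) -(split_decomp E) !compA gm -(compA (mul Y)) -tensmM.
(* The first factor [g · κ · λ] becomes the convolution unit because [λ] preserves the counit. *)
by rewrite !compA gk -(compA (one Y)) le convolution1m.
Qed.

(** [λ] is not assumed multiplicative, but [g] factors through [κ]: products of values of [g] are
    images under [κ] of products in [X], and there [λ] inverts [κ]. *)
Lemma lambda_comp_alg_mor {y : C} {Y : algebra y} {g : hom y (bob A)} :
  is_alg_mor Y (balg A) g -> κ · (λ · g) = g ->
  is_alg_mor Y (balg X) (λ · g).
Proof.
move=> [gm gu] kg; have [_ lu] := lambda_pcoalg E; rewrite /= in lu.
split; last by rewrite -compA gu.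
rewrite -compA gm -kg tensmM (compA (bmul A)).
by rewrite -(proj1 (bmor_alg (kappa E))) !compA lambda_kappa !comp1m.
Qed.

Lemma lambda_comp_coalg_mor {y : C} {Y : coalgebra y} {g : hom y (bob A)} :
  is_coalg_mor Y (bcoalg A) g -> is_coalg_mor Y (bcoalg X) (λ · g).
Proof.
move=> [gd gc]; have [[ld lc] _] := lambda_pcoalg E; rewrite /= in ld lc.
split; last by rewrite compA lc.
by rewrite compA ld -compA gd compA -tensmM.
Qed.

Lemma kappa_kernel : @is_kernel (Bialg C) X A B (kappa E) (alpha E).
Proof.
split.
  by apply: bialg_mor_eq; rewrite Bialg_zeroE bialg_compE alpha_kappa.
move=> Y g /(f_equal (@bmor _ _ _)); rewrite Bialg_zeroE bialg_compE => ag.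
have kg := kappa_lambda_factor (bmor_coalg g) ag.
(* The witness [λ · g] is forced: [κ · h = g] gives [h = λ · g], as [λ] retracts [κ]. *)
exists (BialgMor (lambda_comp_alg_mor (bmor_alg g) kg)
                 (lambda_comp_coalg_mor (bmor_coalg g))); split.
  by apply: bialg_mor_eq; rewrite bialg_compE.
move=> h kh; apply: bialg_mor_eq.
by rewrite /= -kh bialg_compE compA lambda_kappa comp1m.
Qed.

Lemma alpha_cokernel : @is_cokernel (Bialg C) X A B (alpha E) (kappa E).
Proof.
split.
  by apply: bialg_mor_eq; rewrite Bialg_zeroE bialg_compE alpha_kappa.
move=> Y g /(f_equal (@bmor _ _ _)); rewrite Bialg_zeroE bialg_compE => gk.
(* Precomposing [h · α = g] with the section [e] forces [h = g · e]. *)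
exists (bialg_comp g (sect E)); split.
  apply: bialg_mor_eq; rewrite !bialg_compE.
  exact: alpha_cofactor (bmor_alg g) gk.
move=> h <-; apply: bialg_mor_eq.
by rewrite !bialg_compE -compA alpha_sect compm1.
Qed.

Lemma sect_kernel :
  @is_kernel (PCoalg C)
    (pcoalg_of_bialg B) (pcoalg_of_bialg A) (pcoalg_of_bialg X)
    (pcoalg_of_bialg_mor (sect E)) (lambda_mor E).
Proof.
split.
  by apply: pcoalg_mor_eq; rewrite PCoalg_zeroE pcoalg_compE /= lambda_sect.
move=> Y g /(f_equal (@pcmor _ _ _)); rewrite PCoalg_zeroE pcoalg_compE => lg.
(* Here [α] is the retraction of [e], so [e · h = g] forces [h = α · g]. *)
exists (pcoalg_comp (pcoalg_of_bialg_mor (alpha E)) g); split.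
  apply: pcoalg_mor_eq; rewrite !pcoalg_compE.
  exact: sect_alpha_factor (proj1 (pcmorP g)) lg.
move=> h <-; apply: pcoalg_mor_eq.
by rewrite !pcoalg_compE compA /= alpha_sect comp1m.
Qed.

End SplitExtension.

Theorem proposition2p15 (C : sym_mon_cat) (E : split_extension C) :
  @is_kernel (Bialg C) (seX E) (seA E) (seB E) (kappa E) (alpha E) /\
  @is_cokernel (Bialg C) (seX E) (seA E) (seB E) (alpha E) (kappa E) /\
  @is_kernel (PCoalg C)
    (pcoalg_of_bialg (seB E)) (pcoalg_of_bialg (seA E))
    (pcoalg_of_bialg (seX E))
    (pcoalg_of_bialg_mor (sect E)) (lambda_mor E) /\
  @is_short_exact (Bialg C) (seX E) (seA E) (seB E) (kappa E) (alpha E).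
Proof.
have k := kappa_kernel E; have q := alpha_cokernel E.
split; first exact: k.
split; first exact: q.
by split; [exact: sect_kernel | split].
Qed.
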